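(* Suppose that $W_{\bm q}$ is surjective. Then the following statements hold. (1) For every $p\in \bm q\text{-}\mathrm{Sym}_{k,n+1}$ and every $r\in\mathbb{N}$ there is a bijective correspondence between length $r$ $\bm q$-Symmetric decompositions $$p=\sum_{i=1}^r\lambda_i\langle \bm q(\bm\xi_i),\bm X\rangle^k$$ of $p$ over $\mathbb{K}$ and length $r$ Waring decompositions $$\psi_{\bm q}(p)=\sum_{i=1}^r\lambda_i\langle\bm \xi_{i},\bm Z\rangle^{hk}$$ of $\psi_{\bm q}(p)$ over $\mathbb{K}$ (with the same $\lambda_i$ and $\bm\xi_i$ on both sides), where $\lambda_1,\ldots,\lambda_r\in\mathbb{K}\setminus\{0\}$ and $\bm\xi_1,\ldots,\bm\xi_r\in\mathbb{K}^{m+1}$ correspond to different points in $\mathbb{P}^{m}(\mathbb{K})$. (2) The minimal length of a $\bm q$-Symmetric decomposition of $p\in \bm q\text{-}\mathrm{Sym}_{k,n+1}$ over $\mathbb{K}$ is equal to the Waring rank of $\psi_{\bm q}(p)$ over $\mathbb{K}$.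
   Context: Let $\mathbb{K}=\mathbb{R}$ or $\mathbb{C}$, and $m,n,k,h$ positive integers; $\mathbb{N}=\{1,2,\dots\}$. $\mathcal{S}^d(\mathbb{K}^{N+1})$ is the space of homogeneous polynomials (forms) of degree $d$ in $N+1$ variables over $\mathbb{K}$; $M_{d,N+1}=\{\bm\alpha\in\mathbb{N}_0^{N+1}: |\bm\alpha|=d\}$. Variables are $\bm X=(X_0,\dots,X_n)$ for $\mathcal{S}^k(\mathbb{K}^{n+1})$ and $\bm Z=(Z_0,\dots,Z_m)$ for forms in $m+1$ variables. For a tuple $\bm v$, $\langle \bm v,\bm X\rangle=\sum_i v_iX_i$ (no conjugation), and $\bm v^{\bm\alpha}=\prod_i v_i^{\alpha_i}$. Let $\bm q=(q_0,\dots,q_n)$ with $q_i\in\mathcal{S}^h(\mathbb{K}^{m+1})$. The weight function is the linear map $W_{\bm q}:\mathcal{S}^k(\mathbb{K}^{n+1})\to\mathcal{S}^{hk}(\mathbb{K}^{m+1})$, $\bm X^{\bm\alpha}\mapsto \bm q(\bm Z)^{\bm\alpha}$ (substitution $X_i\mapsto q_i$). The apolar product on degree $d$ forms is the bilinear form $\langle f,g\rangle_d=\sum_{\bm\alpha}\binom{d}{\bm\alpha}^{-1}f_{\bm\alpha}g_{\bm\alpha}$ (where $f=\sum f_{\bm\alpha}\bm X^{\bm\alpha}$, $g=\sum g_{\bm\alpha}\bm X^{\bm\alpha}$, $\binom{d}{\bm\alpha}=\frac{d!}{\prod\alpha_i!}$), and $A_d$ is the isomorphism $f\mapsto\langle f,\cdot\rangle_d$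 onto the dual space. Put $\phi_{\bm q}=A_k^{-1}\circ W_{\bm q}^*\circ A_{hk}:\mathcal{S}^{hk}(\mathbb{K}^{m+1})\to\mathcal{S}^k(\mathbb{K}^{n+1})$, where $W_{\bm q}^*$ is the transpose (pullback of functionals), and $\bm q\text{-}\mathrm{Sym}_{k,n+1}:=\mathrm{Im}(\phi_{\bm q})$, the space of $\bm q$-Symmetric tensors. When $W_{\bm q}$ is surjective, $\phi_{\bm q}$ is injective, and $\psi_{\bm q}:\bm q\text{-}\mathrm{Sym}_{k,n+1}\to\mathcal{S}^{hk}(\mathbb{K}^{m+1})$ denotes its inverse on its image. A $\bm q$-Symmetric decomposition over $\mathbb{K}$ of length $r\in\mathbb{N}$ of $p\in\mathcal{S}^k(\mathbb{K}^{n+1})$ is an expression $p=\sum_{i=1}^r\lambda_i\langle\bm q(\bm\xi_i),\bm X\rangle^k$ with $\lambda_i\in\mathbb{K}\setminus\{0\}$ and $\bm\xi_i\in\mathbb{K}^{m+1}$ corresponding to different points of $\mathbb{P}^m(\mathbb{K})$. A Waring decomposition over $\mathbb{K}$ of length $r$ of a form $f$ of degree $d$ in $m+1$ variables is an expression $f=\sum_{i=1}^r\lambda_i\langle\bm\xi_i,\bm Z\rangle^d$ with $\lambda_i\in\mathbb{K}\setminus\{0\}$ and $\bm\xi_i\in\mathbb{K}^{m+1}$ corresponding to different points of $\mathbb{P}^m(\mathbb{K})$; the Waring rank over $\mathbb{K}$ is the smallest $r\in\mathbb{N}$ for which one exists. *)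

(* Defs.v *)
From HB Require Import structures.
From mathcomp Require Import all_boot all_order all_algebra.
From mathcomp Require Import mpoly.
From mathcomp Require Import reals complex.

Set Implicit Arguments.
Unset Strict Implicit.
Unset Printing Implicit Defensive.

Import GRing.Theory.

Local Open Scope ring_scope.

(* [hform K N d] is S^d(K^{N+1}): forms of degree d in the N+1 variables
   'X_0, ..., 'X_N; it carries the vectType structure of [dhomog]. *)
Notation hform K N d := (dhomog N.+1 K d).

Section Apolar.
Context {K : fieldType} {N d : nat}.

Definition multinomial_coef (a : 'X_{1..N.+1}) : K :=
  (d`!)%:R / (\prod_(i < N.+1) (a i)`!)%:R.

Definition apolar (f g : hform K N d) : K^o :=
  \sum_(a : 'X_{1..N.+1 < d.+1} | mdeg a == d)
     (multinomial_coef a)^-1 * f@_a * g@_a.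

Fact apolar_is_linear f : linear (apolar f).
Proof.
move=> c g1 g2; rewrite /apolar scaler_sumr -big_split /=.
by apply: eq_bigr => a _; rewrite mcoeffD mcoeffZ mulrDr mulrCA.
Qed.
HB.instance Definition _ f :=
  GRing.isLinear.Build K (hform K N d) K^o _ (apolar f) (apolar_is_linear f).

Definition apolar_functional (f : hform K N d) : 'Hom(hform K N d, K^o) :=
  linfun (apolar f).

Fact apolar_functional_is_linear : linear apolar_functional.
Proof.
move=> c f1 f2; apply/lfunP => g; rewrite !lfun_simp /= /apolar.
rewrite scaler_sumr -big_split /=.
apply: eq_bigr => a _; rewrite mcoeffD mcoeffZ mulrDr mulrDl.
by rewrite [_ * (c * _)]mulrCA -[c * _ * _]mulrA.
Qed.
HB.instance Definition _ :=
  GRing.isLinear.Build K (hform K N d) 'Hom(hform K N d, K^o) _ apolar_functional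
    apolar_functional_is_linear.

Definition apolar_map : 'Hom(hform K N d, 'Hom(hform K N d, K^o)) :=
  linfun apolar_functional.

End Apolar.

Arguments apolar_map K N d : clear implicits.

Fact multinomial_coef_neq0 (K : fieldType) (N d : nat) (a : 'X_{1..N.+1}) :
  [pchar K] =i pred0 -> multinomial_coef (K := K) (d := d) a != 0.
Proof.
move=> /pcharf0P K0; rewrite mulf_neq0 ?invr_neq0 // K0 -lt0n ?fact_gt0 //.
by rewrite prodn_gt0 // => i; rewrite fact_gt0.
Qed.

Fact apolarX (K : fieldType) (N d : nat) (f : hform K N d) (a : 'X_{1..N.+1})
    (a_homog : 'X_[K, a] \is d.-homog) :
  apolar f (DHomog a_homog) = (multinomial_coef (d := d) a)^-1 * f@_a.
Proof.
have da : mdeg a = d by apply/eqP; move: a_homog; rewrite dhomogX.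
have ltad : (mdeg a < d.+1)%N by rewrite da.
rewrite /apolar (bigD1 (BMultinom ltad)) /=; last by rewrite da.
rewrite mcoeffX eqxx mulr1 big1 ?addr0 // => b /andP[_ b_neq_a].
rewrite mcoeffX; case: eqP => [eq_ab | _]; last by rewrite mulr0.
by case/eqP: b_neq_a; apply: val_inj; rewrite /= eq_ab.
Qed.

Fact lker_apolar_map (K : fieldType) (N d : nat) :
  [pchar K] =i pred0 -> lker (apolar_map K N d) == 0%VS.
Proof.
move=> K0; apply/lker0P/lker0P; rewrite -subv0; apply/subvP => f.
rewrite memv_ker lfunE /= => /eqP /lfunP f0; rewrite memv0; apply/eqP/val_inj.
apply/mpolyP => a /=; rewrite mcoeff0.
have [/eqP da | nda] := boolP (mdeg a == d); last first.
  by apply: (dhomog_nemf_coeff (dhomog_is_dhomog f)).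
have a_homog : 'X_[K, a] \is d.-homog by rewrite dhomogX /= da.
have /eqP := f0 (DHomog a_homog).
rewrite lfunE /= apolarX lfunE /= mulf_eq0 invr_eq0.
by rewrite (negPf (multinomial_coef_neq0 _ _ K0)) => /eqP.
Qed.

Fact limg_apolar_map (K : fieldType) (N d : nat) :
  [pchar K] =i pred0 -> limg (apolar_map K N d) = fullv.
Proof.
move=> K0; apply/eqP; rewrite eqEdim subvf limg_dim_eq; last first.
  by rewrite (eqP (lker_apolar_map N d K0)) capv0.
by rewrite !dimvf; apply: eq_leq; exact: muln1.
Qed.

Section Transpose.
Context {K : fieldType} {U V : vectType K}.

Definition pullback (W : 'Hom(U, V)) (l : 'Hom(V, K^o)) : 'Hom(U, K^o) :=
  (l \o W)%VF.

Fact pullback_is_linear W : linear (pullback W).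
Proof. by move=> c l1 l2; rewrite /pullback comp_lfunDl comp_lfunZl. Qed.
HB.instance Definition _ W :=
  GRing.isLinear.Build K 'Hom(V, K^o) 'Hom(U, K^o) _ (pullback W)
    (pullback_is_linear W).

Definition transpose (W : 'Hom(U, V)) : 'Hom('Hom(V, K^o), 'Hom(U, K^o)) :=
  linfun (pullback W).

End Transpose.

Section QSymmetric.
Context {K : fieldType} {m n h : nat} (k : nat) (q : 'I_n.+1 -> hform K m h).

Definition substitution (p : hform K n k) : {mpoly K[m.+1]} :=
  p \mPo [tuple (q i : {mpoly K[m.+1]}) | i < n.+1].

Fact substitution_homog p : substitution p \is (h * k).-homog.
Proof.
rewrite /substitution comp_mpolyEX big_seq; apply: rpred_sum => a ap.
apply: dhomogZ; rewrite comp_mpolyX.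
have /dhomogP/(_ a ap) /= <- := dhomog_is_dhomog p.
rewrite mdegE big_distrr /=.
elim/big_ind2: _ => [|d1 p1 d2 p2 H1 H2|i _]; first exact: dhomog1.
  exact: dhomogM.
rewrite tnth_mktuple; apply: dhomogMn; exact: (dhomog_is_dhomog (q i)).
Qed.

Definition weight_fun (p : hform K n k) : hform K m (h * k) :=
  DHomog (substitution_homog p).

Fact weight_fun_is_linear : linear weight_fun.
Proof. by move=> c p1 p2; apply: val_inj; rewrite /= /substitution linearP. Qed.
HB.instance Definition _ :=
  GRing.isLinear.Build K (hform K n k) (hform K m (h * k)) _ weight_fun
    weight_fun_is_linear.

Definition weight_map : 'Hom(hform K n k, hform K m (h * k)) := linfun weight_fun.

(* [^-1] is the [lfun] inverse; [apolar_map] is an isomorphism in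
   characteristic 0, see [lker_apolar_map] and [limg_apolar_map]. *)
Definition phi : 'Hom(hform K m (h * k), hform K n k) :=
  ((apolar_map K n k)^-1 \o transpose weight_map \o apolar_map K m (h * k))%VF.

Definition q_sym : {vspace hform K n k} := limg phi.

Fact lker_phi :
  [pchar K] =i pred0 -> limg weight_map = fullv -> lker phi == 0%VS.
Proof.
move=> K0 Wsurj; rewrite -subv0; apply/subvP => f.
rewrite memv_ker memv0 !comp_lfunE => /eqP phi_f0.
set l := transpose _ _ in phi_f0.
have l0 : l = 0.
  have lA : l \in limg (apolar_map K n k) by rewrite limg_apolar_map ?memvf.
  by rewrite -(limg_lfunVK lA) phi_f0 linear0.
have /lker0P A_inj := lker_apolar_map m (h * k) K0.
apply/eqP/A_inj; rewrite linear0; apply/lfunP => g.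
have /memv_imgP[p _ ->] : g \in limg weight_map by rewrite Wsurj memvf.
by have /lfunP/(_ p) := l0; rewrite /l lfunE /= comp_lfunE !zero_lfunE.
Qed.

(* [(phi^-1)%VF] inverts [phi] on its image when [phi] is injective, see
   [phiK] and [psiK]. *)
Definition psi (p : hform K n k) : hform K m (h * k) := (phi^-1)%VF p.

Fact phiK :
  [pchar K] =i pred0 -> limg weight_map = fullv -> cancel phi psi.
Proof. by move=> K0 Wsurj; apply/lker0_lfunK/lker_phi. Qed.

Fact psiK : {in q_sym, cancel psi phi}.
Proof. exact: limg_lfunVK. Qed.

End QSymmetric.

Section Decompositions.
Context {K : fieldType}.

Definition linear_form N (v : 'rV[K]_N) : {mpoly K[N]} :=
  \sum_(i < N) v 0 i *: 'X_i.

Definition eval_forms m n h (q : 'I_n.+1 -> hform K m h) (xi : 'rV[K]_m.+1) :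
    'rV[K]_n.+1 :=
  \row_(i < n.+1) (q i : {mpoly K[m.+1]}).@[fun j => xi 0 j].

Definition same_projective_point N (u v : 'rV[K]_N) : Prop :=
  exists2 c : K, c != 0 & u = c *: v.

(* [D.1] lists the coefficients lambda_i, [D.2] the vectors xi_i. *)
Definition decomposition_data (m r : nat) : Type :=
  ({ffun 'I_r -> K} * {ffun 'I_r -> 'rV[K]_m.+1})%type.

Definition admissible m r (D : decomposition_data m r) : Prop :=
  [/\ forall i, D.1 i != 0,
      forall i, D.2 i != 0
    & forall i j, i != j -> ~ same_projective_point (D.2 i) (D.2 j)].

Definition is_waring_decomposition m d (f : hform K m d) r
    (D : decomposition_data m r) : Prop :=
  admissible D /\
  (f : {mpoly K[m.+1]}) = \sum_(i < r) D.1 i *: linear_form (D.2 i) ^+ d.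

Definition is_q_sym_decomposition m n h k (q : 'I_n.+1 -> hform K m h)
    (p : hform K n k) r (D : decomposition_data m r) : Prop :=
  admissible D /\
  (p : {mpoly K[n.+1]}) =
    \sum_(i < r) D.1 i *: linear_form (eval_forms q (D.2 i)) ^+ k.

Definition waring_decomposition m d (f : hform K m d) (r : nat) : Type :=
  {D : decomposition_data m r | is_waring_decomposition f D}.

Definition q_sym_decomposition m n h k (q : 'I_n.+1 -> hform K m h)
    (p : hform K n k) (r : nat) : Type :=
  {D : decomposition_data m r | is_q_sym_decomposition q p D}.

End Decompositions.

(* Lengths range over the positive integers, also for the zero form. *)
Definition is_least_length (has_length : nat -> Prop) (r : nat) : Prop :=
  [/\ (0 < r)%N, has_length r
    & forall s, (0 < s)%N -> has_length s -> (r <= s)%N].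

Definition is_waring_rank (K : fieldType) m d (f : hform K m d) (r : nat) : Prop :=
  is_least_length (fun s => inhabited (waring_decomposition f s)) r.

Definition is_minimal_q_sym_length (K : fieldType) m n h k
    (q : 'I_n.+1 -> hform K m h) (p : hform K n k) (r : nat) : Prop :=
  is_least_length (fun s => inhabited (q_sym_decomposition q p s)) r.

(* Main.v *)
Require Import Defs.
From HB Require Import structures.
From mathcomp Require Import all_boot all_order all_algebra.
From mathcomp Require Import mpoly.
From mathcomp Require Import reals complex.
From mathcomp Require boolp.

Set Implicit Arguments.
Unset Strict Implicit.
Unset Printing Implicit Defensive.

Import GRing.Theory.

Local Open Scope ring_scope.

(** The apolar product reproduces evaluation: [<<v,Z>^d, g>_d = g(v)].  Hence
    [<phi_q (<xi,Z>^(hk)), g>_k = (W_q g)(xi) = g(q(xi))] for all [g], that is,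
    [phi_q (<xi,Z>^(hk)) = <q(xi),X>^k].  So [phi_q], which is injective when
    [W_q] is surjective, sends a Waring decomposition of [psi_q p] to the
    q-symmetric decomposition of [p] with the same data, and conversely.

    For the minimal lengths to exist, every form, including 0, must have a
    Waring decomposition of positive length.  Evaluating forms of degree [d] at
    the points [(t^((d+1)^i - 1))_i] is Kronecker substitution, so no nonzero
    form vanishes at all small [t], and by duality the powers at these points
    span. *)

(** * Roots at natural numbers in characteristic 0, and uniqueness of base expansions *)

Lemma natr_inj_pchar0 (K : fieldType) :
  [pchar K] =i pred0 -> injective (fun n : nat => n%:R : K).
Proof.
move=> /pcharf0P K0 a b; wlog le_ab : a b / (a <= b)%N.
  move=> wlog_ab; case/orP: (leq_total a b) => [/wlog_ab //|/wlog_ab ba_inj].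
  by move/esym/ba_inj.
move/esym/eqP; rewrite -subr_eq0 -natrB // K0 subn_eq0 => le_ba.
by apply/eqP; rewrite eqn_leq le_ab.
Qed.

Lemma poly_eq0_on_nat (K : fieldType) (p : {poly K}) (n : nat) :
  [pchar K] =i pred0 -> (size p <= n)%N ->
  (forall t, (t < n)%N -> p.[t%:R] = 0) -> p = 0.
Proof.
move=> K0 sz_p p0; apply: (@roots_geq_poly_eq0 _ p [seq t%:R | t <- iota 0 n]).
- apply/allP => x /mapP[t]; rewrite mem_iota add0n => /p0 pt0 ->.
  exact/rootP.
- by rewrite map_inj_uniq ?iota_uniq //; apply: natr_inj_pchar0.
- by rewrite size_map size_iota.
Qed.

(** Reduction modulo [d.+1] recovers the lowest digit; cancelling it and dividing by [d.+1] leaves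
    the remaining digits to the induction. *)
Lemma base_digits_inj (N d : nat) (a b : 'I_N -> nat) :
  (forall i, a i <= d)%N -> (forall i, b i <= d)%N ->
  (\sum_(i < N) a i * d.+1 ^ i = \sum_(i < N) b i * d.+1 ^ i)%N -> a =1 b.
Proof.
elim: N a b => [|N IHN] a b a_le b_le; first by move=> _ [].
have split_sum (c : 'I_N.+1 -> nat) : (\sum_(i < N.+1) c i * d.+1 ^ i =
    (\sum_(i < N) c (lift ord0 i) * d.+1 ^ i) * d.+1 + c ord0)%N.
  rewrite big_ord_recl expn0 muln1 addnC big_distrl /=; congr addn.
  by apply: eq_bigr => i _; rewrite -mulnA -expnSr.
rewrite !split_sum => eq_ab.
have eq0 : a ord0 = b ord0.
  by have /(congr1 (modn^~ d.+1)) := eq_ab; rewrite !modnMDl !modn_small ?ltnS.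
have eqS : (fun i => a (lift ord0 i)) =1 (fun i => b (lift ord0 i)).
  apply: IHN => // [].
  by move/eqP: eq_ab; rewrite eq0 eqn_add2r eqn_pmul2r // => /eqP.
by move=> i; case: (unliftP ord0 i) => [j|] ->; [apply: eqS | apply: eq0].
Qed.

(** * Coefficients of powers of linear forms *)

Section Powers.
Context {K : fieldType}.

Lemma mderiv_exp N (p : {mpoly K[N]}) i d :
  mderiv i (p ^+ d.+1) = d.+1%:R *: (p ^+ d * mderiv i p).
Proof.
elim: d => [|d IHd]; first by rewrite expr1 expr0 mul1r scale1r.
rewrite exprS mderivM IHd -scalerAr mulrA -exprS mulrC.
by rewrite -[X in X + _]scale1r -scalerDl -mulrS.
Qed.

Lemma linear_form_homog N (v : 'rV[K]_N) : linear_form v \is 1.-homog.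
Proof.
by apply: rpred_sum => i _; apply: dhomogZ; rewrite dhomogX /= mdeg1.
Qed.

Lemma linear_form_exp_homog N (v : 'rV[K]_N) d :
  linear_form v ^+ d \is d.-homog.
Proof. by rewrite -{2}[d]mul1n; apply/dhomogMn/linear_form_homog. Qed.

Lemma mderiv_linear_form N (v : 'rV[K]_N) i :
  mderiv i (linear_form v) = (v 0 i)%:MP.
Proof.
rewrite raddf_sum (bigD1 i) //= big1 ?addr0 => [|j j_neq_i].
  rewrite mderivZ mderivX mnm1E eqxx scale1r.
  have -> : (U_(i) - U_(i) = 0 :> 'X_{1..N})%MM.
    by apply/mnmP => j; rewrite mnmBE subnn mnm0E.
  by rewrite mpolyX0 -mul_mpolyC mulr1.
by rewrite mderivZ mderivX mnm1E (negPf j_neq_i) scale0r scaler0.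
Qed.

(* Induction on [d] through [mderiv]: for [a = b + U_(i)], both sides at [a]
   are [d.+1 * v_i] times both sides at [b]. *)
Lemma mcoeff_linear_form_exp N (v : 'rV[K]_N) d (a : 'X_{1..N}) :
  mdeg a = d ->
  (\prod_i (a i)`!)%:R * (linear_form v ^+ d)@_a =
    d`!%:R * \prod_i v 0 i ^+ a i.
Proof.
elim: d a => [|d IHd] a da.
  move/eqP: da; rewrite mdeg_eq0 => /eqP->.
  by rewrite expr0 mcoeff1 eqxx !big1 ?mulr1 // => i _; rewrite mnm0E.
have [i ai] : exists i, (0 < a i)%N.
  apply/existsP; apply: contra_eqT da => /existsPn a0.
  by rewrite mdegE big1 // => i _; apply/eqP; rewrite -leqn0 leqNgt.
pose b := (a - U_(i))%MM.
have ab : a = (b + U_(i))%MM.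
  rewrite submK //; apply/mnm_lepP => j; rewrite mnm1E.
  by case: eqP => // <-.
have db : mdeg b = d by move: da; rewrite ab mdegD mdeg1 addn1 => -[].
have aj j : j != i -> a j = b j.
  by rewrite ab mnmDE mnm1E eq_sym => /negPf->; rewrite addn0.
have aiS : a i = (b i).+1 by rewrite ab mnmDE mnm1E eqxx addn1.
(* The coefficient at [b] of the [i]-th derivative of the power, computed in two ways. *)
have deriv_eq : (linear_form v ^+ d.+1)@_a *+ (b i).+1 =
    d.+1%:R * (v 0 i * (linear_form v ^+ d)@_b).
  rewrite {1}ab -mcoeff_mderiv mderiv_exp mderiv_linear_form mcoeffZ.
  by rewrite [_ * _%:MP]mulrC mcoeffCM.
have := IHd b db.
rewrite (bigD1 i) //= [in X in _ = _ * X](bigD1 i) //= => IHb.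
rewrite (bigD1 i) //= [in X in _ = _ * X](bigD1 i) //= aiS factS.
rewrite (eq_bigr (fun j => (b j)`!)); last by move=> j /aj->.
rewrite (eq_bigr (fun j => v 0 j ^+ b j)); last by move=> j /aj->.
have -> : ((b i).+1 * (b i)`! * \prod_(j < N | j != i) (b j)`!)%:R *
      (linear_form v ^+ d.+1)@_a =
    ((b i)`! * \prod_(j < N | j != i) (b j)`!)%:R *
      ((linear_form v ^+ d.+1)@_a *+ (b i).+1) :> K.
  by rewrite -mulnA mulnC natrM -mulrA [_.+1%:R * _]mulr_natl.
rewrite deriv_eq mulrCA [X in _ * X]mulrCA IHb exprS natrM -!mulrA.
congr (_ * _); exact: mulrCA.
Qed.

(** * Apolar products with powers, and the image of a power under [phi] *)

Definition power_form N d (v : 'rV[K]_N.+1) : hform K N d :=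
  DHomog (linear_form_exp_homog v d).

(** Indexes the value by the same monomials as [apolar], so that the two sums can be compared term
    by term. *)
Lemma meval_homogE N d (g : hform K N d) (v : 'I_N.+1 -> K) :
  (g : {mpoly K[N.+1]}).@[v] =
    \sum_(a : 'X_{1..N.+1 < d.+1} | mdeg a == d) g@_a * \prod_i v i ^+ a i.
Proof.
have sz_g : (msize (g : {mpoly K[N.+1]}) <= d.+1)%N.
  rewrite mmeasureE; apply/bigmax_leqP_seq => a ag _.
  by have /dhomogP/(_ a ag) /= -> := dhomog_is_dhomog g.
rewrite {1}(mpolywE sz_g) raddf_sum.
rewrite (bigID (fun a : 'X_{1..N.+1 < d.+1} => mdeg a == d)) /=.
rewrite [X in _ + X]big1 ?addr0 => [|a nda].
  by apply: eq_bigr => a _; rewrite mevalZ mevalX.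
by rewrite (dhomog_nemf_coeff (dhomog_is_dhomog g) nda) scale0r raddf0.
Qed.

Lemma apolar_power_form N d (v : 'rV[K]_N.+1) (g : hform K N d) :
  [pchar K] =i pred0 ->
  apolar (power_form d v) g = (g : {mpoly K[N.+1]}).@[v 0].
Proof.
move=> K0; rewrite meval_homogE; apply: eq_bigr => a /eqP da.
rewrite mulrC; congr (_ * _); rewrite /multinomial_coef invf_div /=.
have d0 : d`!%:R != 0 :> K by rewrite (pcharf0P K).1 -?lt0n ?fact_gt0.
by rewrite mulrAC mcoeff_linear_form_exp // mulrAC divff ?mul1r.
Qed.

Lemma apolarC N d (f g : hform K N d) : apolar f g = apolar g f.
Proof. by apply: eq_bigr => a _; rewrite mulrAC. Qed.

Lemma apolar_mapE N d (f g : hform K N d) : apolar_map K N d f g = apolar f g.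
Proof. by rewrite !lfunE. Qed.

Lemma phi_power_form m n h k (q : 'I_n.+1 -> hform K m h) (xi : 'rV[K]_m.+1) :
  [pchar K] =i pred0 ->
  phi k q (power_form (h * k) xi) = power_form k (eval_forms q xi).
Proof.
move=> K0; rewrite /phi !comp_lfunE.
set l := transpose _ _.
(* As [apolar_map] is injective, its inverse can be avoided by comparing functionals. *)
suff -> : l = apolar_map K n k (power_form k (eval_forms q xi)).
  by apply: lker0_lfunK; apply: lker_apolar_map.
apply/lfunP => g; rewrite /l lfunE /= /pullback comp_lfunE !apolar_mapE.
rewrite !apolar_power_form // lfunE /= /substitution comp_mpoly_meval.
by apply: meval_eq => i; rewrite tnth_mktuple mxE.
Qed.


(** * Kronecker substitution and the span of powers *)

(* The shift by one in the exponents makes the first coordinate 1; on monomials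
   of degree [d] it only lowers the resulting exponent by [d]. *)
Definition kronecker_point N d (t : nat) : 'rV[K]_N.+1 :=
  \row_(i < N.+1) t%:R ^+ (d.+1 ^ i).-1.

(** Along these points [f] becomes a univariate polynomial [P] in [t]. The monomial [a] turns into
    [t] to the [w a], and [w] is injective on the support, so [P] has the coefficients of [f]; its
    degree is less than the number of zeros. *)
Lemma hform_eq0_kronecker N d (f : hform K N d) :
  [pchar K] =i pred0 ->
  (forall t, (t <= d * d.+1 ^ N)%N ->
     (f : {mpoly K[N.+1]}).@[kronecker_point N d t 0] = 0) ->
  f = 0.
Proof.
move=> K0 f0; pose w (a : 'X_{1..N.+1}) := (\sum_i a i * (d.+1 ^ i).-1)%N.
have mdeg_f a : a \in msupp f -> mdeg a = d.
  by move=> af; have /dhomogP/(_ a af) := dhomog_is_dhomog f.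
have le_d a i : a \in msupp f -> (a i <= d)%N.
  by move=> /mdeg_f <-; rewrite mdegE (bigD1 i) //= leq_addr.
have wE a : a \in msupp f -> (w a + d = \sum_i a i * d.+1 ^ i)%N.
  move=> /mdeg_f {1}<-; rewrite mdegE -big_split; apply: eq_bigr => i _ /=.
  by rewrite -mulnSr prednK // expn_gt0.
have w_inj : {in msupp f &, injective w}.
  move=> a b af bf eq_w; apply/mnmP/(@base_digits_inj _ d) => [i|i|].
  - exact: le_d.
  - exact: le_d.
  - by rewrite -!wE // eq_w.
have w_le a : a \in msupp f -> (w a <= d * d.+1 ^ N)%N.
  move=> af; rewrite -{1}(mdeg_f a af) mdegE big_distrl leq_sum // => i _.
  rewrite leq_mul2l; apply/orP; right; apply: leq_trans (leq_pred _) _.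
  by rewrite leq_pexp2l // -ltnS.
pose P : {poly K} := \sum_(a <- msupp f) f@_a *: 'X^(w a).
have P0 : P = 0.
  apply: (@poly_eq0_on_nat _ _ (d * d.+1 ^ N).+1) => // [|t /f0 <-].
    rewrite /P big_seq; apply: (leq_trans (size_sum _ _ _)).
    apply/bigmax_leqP_seq => a _ af; apply: leq_trans (size_scale_leq _ _) _.
    by rewrite size_polyXn ltnS w_le.
  rewrite mevalE horner_sum; apply: eq_bigr => a _.
  rewrite hornerZ hornerXn; congr (_ * _).
  rewrite /w expr_sum; apply: eq_bigr => i _.
  by rewrite mxE -exprM mulnC.
apply/val_inj/mpolyP => a; rewrite /= mcoeff0.
have [af|] := boolP (a \in msupp f); last by rewrite -mcoeff_eq0 => /eqP.
have := congr1 (coefp (w a)) P0; rewrite /= coef0 coef_sum (bigD1_seq a) //=.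
rewrite coefZ coefXn eqxx mulr1 big_seq_cond big1 ?addr0 // => b.
case/andP=> bf b_neq_a; rewrite coefZ coefXn; case: eqP => [/w_inj eq_ab|_].
  by case/eqP: b_neq_a; rewrite eq_ab.
by rewrite mulr0.
Qed.

(** Subtracting the projection onto [U] kills [U] but not a vector [w] outside it; some coordinate
    of the result at [w] is then nonzero. *)
Lemma proper_subspace_functional (V : vectType K) (U : {vspace V}) :
  U != fullv ->
  exists2 l : 'Hom(V, K^o), l != 0 & forall u, u \in U -> l u = 0.
Proof.
rewrite eqEsubv subvf /= => /subvPn[w _ wU].
pose P : 'End(V) := (\1 - projv U)%VF.
have Pw : P w != 0.
  rewrite /P add_lfunE opp_lfunE id_lfunE subr_eq0; apply: contra wU => /eqP->.
  exact: memv_proj.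
have [i wi] : exists i, coord (vbasis {:V}) i (P w) != 0.
  apply/existsP; apply: contraNT Pw => /existsPn w0.
  rewrite (coord_vbasis (memvf (P w))) big1 // => i _.
  by have := w0 i; rewrite negbK => /eqP->; rewrite scale0r.
exists (linfun (coord (vbasis {:V}) i : V -> K^o) \o P)%VF.
  by apply: contraNneq wi => /lfunP/(_ w); rewrite comp_lfunE !lfunE => ->.
move=> u uU; rewrite comp_lfunE lfunE /= /P add_lfunE opp_lfunE id_lfunE.
by rewrite projv_id // subrr raddf0.
Qed.

Lemma power_forms_span N d :
  [pchar K] =i pred0 ->
  <<[seq power_form d (kronecker_point N d t)
       | t <- iota 0 (d * d.+1 ^ N).+1]>>%VS = fullv.
Proof.
move=> K0; apply/eqP/negPn/negP => /proper_subspace_functional[l l_neq0 l0].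
(* The functional is the apolar product with some [f], so killing the powers means that [f] vanishes
   at the points. *)
have /memv_imgP[f _ lE] : l \in limg (apolar_map K N d).
  by rewrite limg_apolar_map ?memvf.
suff f0 : f = 0 by rewrite lE f0 raddf0 eqxx in l_neq0.
apply: hform_eq0_kronecker => // t le_t.
rewrite -apolar_power_form // apolarC -apolar_mapE -lE; apply: l0.
by apply/memv_span/mapP; exists t; rewrite ?mem_iota.
Qed.

(** Coordinate 0 is 1 at every point, which forces the scalar to be 1; coordinate 1 is the [d]-th
    power of the parameter and separates the points. *)
Lemma kronecker_points_distinct N d s t :
  [pchar K] =i pred0 -> (0 < N)%N -> (0 < d)%N ->
  same_projective_point (kronecker_point N d s) (kronecker_point N d t) ->
  s = t.
Proof.
move=> K0 N0 d0 [c _ /rowP eq_st].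
have := eq_st ord0; rewrite !mxE expn0 !expr0 mulr1 => c1.
have lt1 : (1 < N.+1)%N by [].
have := eq_st (Ordinal lt1); rewrite !mxE -c1 mul1r /= -!natrX.
by move/(natr_inj_pchar0 K0)/eqP; rewrite eqn_exp2r // => /eqP.
Qed.

(** * Existence of Waring decompositions and transfer through [phi] *)

Lemma waring_decomposition_exists N d (f : hform K N d) :
  [pchar K] =i pred0 -> (0 < N)%N -> (0 < d)%N ->
  exists2 r, (0 < r)%N & inhabited (waring_decomposition f r).
Proof.
move=> K0 N0 d0; pose M := (d * d.+1 ^ N).+1.
(* The power at one extra point is split off with coefficient 1, so that the
   decomposition is nonempty even when [f = 0]. *)
pose P t := power_form d (kronecker_point N d t).
pose X := [tuple P t | t < M].
have : f - P M \in <<X>>%VS.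
  suff -> : <<X>>%VS = fullv by apply: memvf.
  rewrite -(power_forms_span N d K0); congr <<_>>%VS.
  by rewrite -val_enum_ord -map_comp.
move=> /coord_span; set c := coord X => fE.
pose e (t : 'I_M.+1) : K :=
  if unlift ord_max t is Some j then c j (f - P M) else 1.
(* Admissible data have nonzero coefficients, so only these indices are kept; the extra index
   [ord_max], with coefficient 1, is among them. *)
pose A := [set t | e t != 0].
have {}fE : f = \sum_(t in A) e t *: P t.
  transitivity (\sum_t e t *: P t); last first.
    rewrite (bigID (mem A)) /= [X in _ + X]big1 ?addr0 // => t.
    by rewrite inE negbK => /eqP->; rewrite scale0r.
  rewrite big_ord_recr /= /e unlift_none scale1r -[LHS](subrK (P M)) {1}fE.
  congr (_ + _); apply: eq_bigr => i _.
  rewrite -tnth_nth tnth_mktuple.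
  have -> : widen_ord (leqnSn M) i = lift ord_max i.
    by apply: val_inj; rewrite /= /bump leqNgt ltn_ord.
  by rewrite liftK.
exists #|A|.
  by apply/card_gt0P; exists ord_max; rewrite inE /e unlift_none oner_eq0.
constructor.
exists ([ffun i : 'I_#|A| => e (enum_val i)],
        [ffun i : 'I_#|A| => kronecker_point N d (enum_val i)]).
split=> [|/=]; last first.
  rewrite {1}fE big_enum_val raddf_sum; apply: eq_bigr => i _.
  by rewrite !ffunE.
split=> [i|i|i j i_neq_j] /=; rewrite !ffunE.
- by have := enum_valP i; rewrite inE.
- apply/negP => /eqP/rowP/(_ ord0); rewrite !mxE expn0 expr0.
  by apply/eqP/oner_neq0.
- move/(kronecker_points_distinct K0 N0 d0)/val_inj/enum_val_inj/eqP.
  exact/negP.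
Qed.

Lemma q_sym_decompositionP m n h k (q : 'I_n.+1 -> hform K m h)
    (p : hform K n k) r (D : decomposition_data m r) :
  [pchar K] =i pred0 -> limg (weight_map k q) = fullv -> p \in q_sym k q ->
  is_q_sym_decomposition q p D <-> is_waring_decomposition (psi q p) D.
Proof.
move=> K0 Wsurj p_sym; rewrite /is_q_sym_decomposition /is_waring_decomposition.
pose f := \sum_i D.1 i *: power_form (h * k) (D.2 i).
have fE : val f = \sum_i D.1 i *: linear_form (D.2 i) ^+ (h * k).
  by rewrite raddf_sum.
have phi_fE : val (phi k q f) =
    \sum_i D.1 i *: linear_form (eval_forms q (D.2 i)) ^+ k.
  rewrite linear_sum raddf_sum; apply: eq_bigr => i _.
  by rewrite linearZ /= phi_power_form.
rewrite -fE -phi_fE; split=> -[admD /val_inj eq_f]; split=> //.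
  by rewrite eq_f phiK.
by rewrite -eq_f psiK.
Qed.

End Powers.

Lemma exists_least_length (P : nat -> Prop) :
  (exists2 r, (0 < r)%N & P r) -> exists r, is_least_length P r.
Proof.
move=> [r r_gt0 Pr].
(* [ex_minn] takes a boolean predicate, so [P] is made boolean classically. *)
have exP : exists r, (0 < r)%N && boolp.asbool (P r).
  by exists r; rewrite r_gt0; apply/boolp.asboolP.
exists (ex_minn exP); case: ex_minnP => s /andP[s_gt0 /boolp.asboolP Ps] s_min.
by split=> // t t_gt0 Pt; apply: s_min; rewrite t_gt0; apply/boolp.asboolP.
Qed.

Theorem theorem3p17 (R : realType) (K : fieldType)
    (K_real_or_complex : K = R :> fieldType \/ K = R[i] :> fieldType)
    (m n k h : nat)
    (m_gt0 : (0 < m)%N) (n_gt0 : (0 < n)%N)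
    (k_gt0 : (0 < k)%N) (h_gt0 : (0 < h)%N)
    (q : 'I_n.+1 -> hform K m h)
    (weight_surjective : limg (weight_map k q) = fullv) :
  (forall (p : hform K n k) (r : nat), p \in q_sym k q -> (0 < r)%N ->
     exists F : q_sym_decomposition q p r -> waring_decomposition (psi q p) r,
       bijective F /\ forall D, sval (F D) = sval D)
  /\
  (forall p : hform K n k, p \in q_sym k q ->
     exists r : nat,
       is_minimal_q_sym_length q p r /\ is_waring_rank (psi q p) r).
Proof.
have K0 : [pchar K] =i pred0.
  by case: K_real_or_complex => ->; apply: Num.Theory.pchar_num.
have decP p r (D : decomposition_data m r) (p_sym : p \in q_sym k q) :=
  q_sym_decompositionP D K0 weight_surjective p_sym.
split=> [p r p_sym _|p p_sym].
  pose F (D : q_sym_decomposition q p r) : waring_decomposition (psi q p) r :=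
    exist _ (sval D) ((decP p r _ p_sym).1 (svalP D)).
  pose G (D : waring_decomposition (psi q p) r) : q_sym_decomposition q p r :=
    exist _ (sval D) ((decP p r _ p_sym).2 (svalP D)).
  (* [F] and [G] keep the data and change only the proof component, so they are mutually inverse by
     proof irrelevance. *)
  exists F; split=> //; exists G => -[D HD];
    exact/eq_exist_curried/boolp.Prop_irrelevance.
have len_iff s : inhabited (q_sym_decomposition q p s) <->
    inhabited (waring_decomposition (psi q p) s).
  by split=> -[[D HD]]; constructor; exists D; apply/decP.
have hk_gt0 : (0 < h * k)%N by rewrite muln_gt0 h_gt0.
have [r [r_gt0 lr r_min]] := exists_least_length
  (waring_decomposition_exists (psi q p) K0 m_gt0 hk_gt0).
exists r; split; split=> //; first exact/len_iff.
by move=> s s_gt0 /len_iff; apply: r_min.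
Qed.
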